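(* Let $R$ be a ring. The following statements are equivalent. 1. The ring $R$ has a semisimple left quotient ring $Q$. 2. All of the following hold: (a) $R$ is a semiprime ring. (b) The set $\mathrm{Min}(R)$ of minimal primes of $R$ is a finite set, say $\{\mathfrak a_1,\ldots,\mathfrak a_n\}$ (with $\mathfrak a_1,\dots,\mathfrak a_n$ distinct). (c) For each $i=1,\ldots,n$, the set $S_i:=\pi_i^{-1}(\mathcal C_{\overline R_i})=\{c\in R\mid c+\mathfrak a_i\in\mathcal C_{\overline R_i}\}$ is a left denominator set of $R$ with $\mathrm{ass}(S_i)=\mathfrak a_i$, where $\pi_i:R\to\overline R_i:=R/\mathfrak a_i$, $r\mapsto r+\mathfrak a_i$. (d) For each $i=1,\ldots,n$, the ring $R_i:=S_i^{-1}R$ is a simple left Artinian ring. If one of the two equivalent conditions holds then $\mathrm{max.Den}_l(R)=\{S_1,\ldots,S_n\}$ and $Q\simeq\prod_{i=1}^nR_i$.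
   Context: Rings are associative with $1\neq0$. A multiplicative subset of a ring $R$ is a subset $S$ closed under multiplication with $1\in S$, $0\notin S$. It is a left Ore set if $Sr\cap Rs\neq\emptyset$ for all $r\in R$, $s\in S$. For such $S$ put $\mathrm{ass}(S):=\{r\in R\mid sr=0\text{ for some }s\in S\}$ (an ideal of $R$). A left Ore set $S$ is a left denominator set if $rs=0$ with $r\in R,s\in S$ implies $r\in\mathrm{ass}(S)$. Then $S^{-1}R=\{s^{-1}r\mid s\in S,r\in R\}$ is the left localization of $R$ at $S$. $\mathrm{max.Den}_l(R)$ is the set of left denominator sets of $R$ that are maximal with respect to inclusion. $\mathcal C_R$ is the set of regular elements (non-zero-divisors) of a ring $R$. The ring $R$ has a left quotient ring $Q$ if $\mathcal C_R$ is a left Ore set, and then $Q:=\mathcal C_R^{-1}R$. Semisimple means semisimple Artinian. *)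

(* Defs.v *)
From HB Require Import structures.
From mathcomp Require Import all_boot all_algebra.
From mathcomp Require Import boolp classical_sets.

Set Implicit Arguments.
Unset Strict Implicit.
Unset Printing Implicit Defensive.

Import GRing.Theory.
Local Open Scope ring_scope.
Local Open Scope classical_set_scope.
Local Open Scope quotient_scope.

(* Rings are [nzRingType]: associative, unital, 1 != 0, not necessarily
   commutative.  Subsets are Prop-valued [set R], as nothing is decidable. *)

Section Ideals.
Variable R : nzRingType.

(* Closure under opposites follows by multiplying by -1. *)
Definition left_ideal (I : set R) : Prop :=
  [/\ I 0, forall x y, I x -> I y -> I (x + y)
    & forall r x, I x -> I (r * x)].

Definition twosided_ideal (I : set R) : Prop :=
  left_ideal I /\ forall r x, I x -> I (x * r).

(* The product ideal I J is contained in the additively closed set P iff all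
   the products x * y are. *)
Definition prime_ideal (P : set R) : Prop :=
  [/\ twosided_ideal P, P != setT
    & forall I J, twosided_ideal I -> twosided_ideal J ->
      (forall x y, I x -> J y -> P (x * y)) -> I `<=` P \/ J `<=` P].

Definition minimal_primes : set (set R) :=
  [set P | prime_ideal P /\
           forall P', prime_ideal P' -> P' `<=` P -> P' = P].

Definition semiprime_ring : Prop :=
  forall I, twosided_ideal I -> (forall x y, I x -> I y -> x * y = 0) ->
    I = [set 0].

Definition simple_ring : Prop :=
  forall I, twosided_ideal I -> I = [set 0] \/ I = setT.

Definition left_artinian : Prop :=
  forall I : nat -> set R, (forall k, left_ideal (I k)) ->
    (forall k, I k.+1 `<=` I k) ->
    exists m, forall k, (m <= k)%N -> I k = I m.

(* The left regular module is semisimple (every submodule is a direct summand)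
   and Artinian. *)
Definition semisimple_artinian : Prop :=
  (forall I, left_ideal I -> exists J, [/\ left_ideal J,
     I `&` J = [set 0] & forall r, exists x y, [/\ I x, J y & r = x + y]])
  /\ left_artinian.

End Ideals.

Arguments minimal_primes : clear implicits.

Section Denominators.
Variable R : nzRingType.
Implicit Type S : set R.

Definition multiplicative_set S : Prop :=
  [/\ S 1, ~ S 0 & forall s t, S s -> S t -> S (s * t)].

Definition left_ore S : Prop :=
  multiplicative_set S /\
  forall r s, S s -> exists s' r', S s' /\ s' * r = r' * s.

Definition ass S : set R := [set r | exists s, S s /\ s * r = 0].

Definition left_denominator S : Prop :=
  left_ore S /\ forall r s, S s -> r * s = 0 -> ass S r.

Definition max_left_denominators : set (set R) :=
  [set S | left_denominator S /\
           forall S', left_denominator S' -> S `<=` S' -> S' = S].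

(* (Q, f) is a left localization of R at S: elements of S become invertible,
   every element of Q has the form (f s)^-1 * f r, and the kernel of f is
   ass S.  This determines (Q, f) up to a unique isomorphism under R. *)
Definition is_left_localization S (Q : nzRingType) (f : {rmorphism R -> Q}) :
    Prop :=
  [/\ forall s, S s -> exists u, u * f s = 1 /\ f s * u = 1,
      forall q, exists s u r,
        [/\ S s, u * f s = 1, f s * u = 1 & q = u * f r]
    & forall r, f r = 0 <-> ass S r].

End Denominators.

Arguments max_left_denominators : clear implicits.

Definition regular_elements (R : pzRingType) : set R :=
  [set c | GRing.lreg c /\ GRing.rreg c].
Arguments regular_elements : clear implicits.

(* The quotient ring R / I.  The additive group is the library's quotient; the
   library provides the multiplication only for commutative R.  It is a
   [pzRingType] because I = R is allowed here. *)

Record ideal (R : nzRingType) :=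
  Ideal { ideal_set :> set R; idealP : twosided_ideal ideal_set }.

Section QuotientRing.
Variables (R : nzRingType) (I : ideal R).

Definition ideal_pred : {pred R} := fun x => `[< ideal_set I x >].

Lemma ideal_predP x : reflect (ideal_set I x) (x \in ideal_pred).
Proof. exact: asboolP. Qed.

Lemma ideal_pred_zmod_closed : zmod_closed ideal_pred.
Proof.
have [[I0 ID IM] _] := idealP I.
split=> [|x y /ideal_predP Ix /ideal_predP Iy]; apply/ideal_predP => //.
by apply: ID => //; rewrite -mulN1r; apply: IM.
Qed.

HB.instance Definition _ := GRing.isZmodClosed.Build R ideal_pred
  ideal_pred_zmod_closed.

Definition quot_ring : Type := Quotient.quot ideal_pred.
HB.instance Definition _ := GRing.Zmodule.on quot_ring.

Definition quot_pi (x : R) : quot_ring := \pi_(Quotient.quot ideal_pred) x.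
Definition quot_repr (x : quot_ring) : R := repr (x : Quotient.quot ideal_pred).

Lemma quot_reprK : cancel quot_repr quot_pi.
Proof. exact: reprK. Qed.

Lemma quot_pi_eq x y : quot_pi x = quot_pi y <-> ideal_set I (x - y).
Proof.
rewrite /quot_pi; split=> [/eqP|Ixy]; last apply/eqP.
  by rewrite -Quotient.idealrBE => /ideal_predP.
by rewrite -Quotient.idealrBE; apply/ideal_predP.
Qed.

Definition quot_mul (x y : quot_ring) : quot_ring :=
  quot_pi (quot_repr x * quot_repr y).

Lemma quot_piD x y : quot_pi (x + y) = quot_pi x + quot_pi y.
Proof. exact: Quotient.pi_add. Qed.

Lemma quot_pi_mul x y : quot_pi (x * y) = quot_mul (quot_pi x) (quot_pi y).
Proof.
have [[I0 ID IM] IMr] := idealP I.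
set x' := quot_repr (quot_pi x); set y' := quot_repr (quot_pi y).
have Ix : ideal_set I (x - x') by apply/quot_pi_eq; rewrite quot_reprK.
have Iy : ideal_set I (y - y') by apply/quot_pi_eq; rewrite quot_reprK.
apply/quot_pi_eq; rewrite -/x' -/y'.
rewrite -(subrK (x' * y) (x * y)) -mulrBl -addrA -mulrBr.
by apply: ID; [apply: IMr | apply: IM].
Qed.

Lemma quot_mulA : associative quot_mul.
Proof.
move=> x y z; rewrite -[x]quot_reprK -[y]quot_reprK -[z]quot_reprK.
by rewrite -!quot_pi_mul mulrA.
Qed.

Lemma quot_mul1 : left_id (quot_pi 1) quot_mul.
Proof. by move=> x; rewrite -[x]quot_reprK -quot_pi_mul mul1r. Qed.

Lemma quot_mulr1 : right_id (quot_pi 1) quot_mul.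
Proof. by move=> x; rewrite -[x]quot_reprK -quot_pi_mul mulr1. Qed.

Lemma quot_mulDl : left_distributive quot_mul +%R.
Proof.
move=> x y z; rewrite -[x]quot_reprK -[y]quot_reprK -[z]quot_reprK.
by rewrite -quot_piD -!quot_pi_mul mulrDl quot_piD.
Qed.

Lemma quot_mulDr : right_distributive quot_mul +%R.
Proof.
move=> x y z; rewrite -[x]quot_reprK -[y]quot_reprK -[z]quot_reprK.
by rewrite -quot_piD -!quot_pi_mul mulrDr quot_piD.
Qed.

HB.instance Definition _ := GRing.Zmodule_isPzRing.Build quot_ring
  quot_mulA quot_mul1 quot_mulr1 quot_mulDl quot_mulDr.

Lemma quot_pi_zmod_morphism : zmod_morphism quot_pi.
Proof.
move=> x y; apply: (addIr (quot_pi y)).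
by rewrite -quot_piD !subrK.
Qed.

HB.instance Definition _ := GRing.isZmodMorphism.Build R quot_ring quot_pi
  quot_pi_zmod_morphism.

Lemma quot_pi_monoid_morphism : monoid_morphism quot_pi.
Proof. by split=> // x y; rewrite quot_pi_mul. Qed.

HB.instance Definition _ := GRing.isMonoidMorphism.Build R quot_ring quot_pi
  quot_pi_monoid_morphism.

Lemma quot_pi_eq0 x : quot_pi x = 0 <-> ideal_set I x.
Proof. by rewrite -(raddf0 quot_pi) quot_pi_eq subr0. Qed.

Definition regular_preimage : set R :=
  quot_pi @^-1` regular_elements quot_ring.

End QuotientRing.

Section ProductRing.
Variables (I : finType) (T : I -> nzRingType).
Local Notation prodT := {dffun forall i, T i}.
Implicit Types x y : prodT.

Definition rprod_zero : prodT := [ffun=> 0].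
Definition rprod_opp x : prodT := [ffun i => - x i].
Definition rprod_add x y : prodT := [ffun i => x i + y i].
Definition rprod_one : prodT := [ffun=> 1].
Definition rprod_mul x y : prodT := [ffun i => x i * y i].

Lemma rprod_addA : associative rprod_add.
Proof. by move=> x y z; apply/ffunP=> i; rewrite !ffunE addrA. Qed.
Lemma rprod_addC : commutative rprod_add.
Proof. by move=> x y; apply/ffunP=> i; rewrite !ffunE addrC. Qed.
Lemma rprod_add0 : left_id rprod_zero rprod_add.
Proof. by move=> x; apply/ffunP=> i; rewrite !ffunE add0r. Qed.
Lemma rprod_addN : left_inverse rprod_zero rprod_opp rprod_add.
Proof. by move=> x; apply/ffunP=> i; rewrite !ffunE addNr. Qed.

HB.instance Definition _ := GRing.isZmodule.Build prodT
  rprod_addA rprod_addC rprod_add0 rprod_addN.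

Lemma rprod_mulA : associative rprod_mul.
Proof. by move=> x y z; apply/ffunP=> i; rewrite !ffunE mulrA. Qed.
Lemma rprod_mul1 : left_id rprod_one rprod_mul.
Proof. by move=> x; apply/ffunP=> i; rewrite !ffunE mul1r. Qed.
Lemma rprod_mulr1 : right_id rprod_one rprod_mul.
Proof. by move=> x; apply/ffunP=> i; rewrite !ffunE mulr1. Qed.
Lemma rprod_mulDl : left_distributive rprod_mul rprod_add.
Proof. by move=> x y z; apply/ffunP=> i; rewrite !ffunE mulrDl. Qed.
Lemma rprod_mulDr : right_distributive rprod_mul rprod_add.
Proof. by move=> x y z; apply/ffunP=> i; rewrite !ffunE mulrDr. Qed.

HB.instance Definition _ := GRing.Zmodule_isPzRing.Build prodT
  rprod_mulA rprod_mul1 rprod_mulr1 rprod_mulDl rprod_mulDr.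

End ProductRing.

Section Conditions.
Variable R : nzRingType.

Definition left_quotient_ring (Q : nzRingType) (f : {rmorphism R -> Q}) : Prop :=
  left_ore (regular_elements R) /\
  is_left_localization (regular_elements R) f.

Definition has_semisimple_left_quotient_ring : Prop :=
  exists (Q : nzRingType) (f : {rmorphism R -> Q}),
    left_quotient_ring f /\ semisimple_artinian Q.

(* Min(R) is finite, with a_0, ..., a_(n-1) its distinct elements. *)
Definition enumerates_minimal_primes n (a : 'I_n -> ideal R) : Prop :=
  injective (fun i => ideal_set (a i)) /\
  range (fun i => ideal_set (a i)) = minimal_primes R.

Definition minimal_prime_conditions : Prop :=
  semiprime_ring R /\
  exists (n : nat) (a : 'I_n -> ideal R),
    [/\ enumerates_minimal_primes a,
        forall i, left_denominator (regular_preimage (a i)) /\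
                  ass (regular_preimage (a i)) = ideal_set (a i)
      & forall i, exists (Ri : nzRingType) (fi : {rmorphism R -> Ri}),
          [/\ is_left_localization (regular_preimage (a i)) fi,
              simple_ring Ri & left_artinian Ri]].

End Conditions.

(* Main.v *)
Require Import Defs.
From HB Require Import structures.
From mathcomp Require Import all_boot all_algebra.
From mathcomp Require Import boolp classical_sets.

Import GRing.Theory.
Local Open Scope ring_scope.
Local Open Scope classical_set_scope.

(** Let [R] have a semisimple left quotient ring [Q].  Then [Q] is a finite
    product of simple Artinian rings [Q / ann e], one for each primitive central
    idempotent [e], and the kernels [component e] of the maps [R -> Q / ann e]
    are prime, pairwise incomparable and of zero intersection; hence they are the
    minimal primes of [R] ([minimal_primes_components]).  Primeness, like
    semiprimeness of [R], comes from [Q] because ideals of [R] extend to ideals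
    of [Q] ([loc_ext_twosided]).  In an Artinian ring a right regular element is
    a unit, so [R -> Q / ann e] inverts everything regular modulo [component e];
    it is therefore the localization at the set [S_e] of these elements
    ([component_localization]).

    Any left denominator set [S] lies in some [S_e]: the extension of [ass S] to
    [Q] is a proper ideal, so it misses some [e], and then [S] becomes right
    regular, hence invertible, in [Q / ann e] ([denominator_sub_regular_mod]).
    As the [S_e] are pairwise incomparable, they are the maximal left denominator
    sets.

    Conversely, assume the conditions on the minimal primes [a_i].  Semiprimeness
    gives that their intersection is zero ([semiprime_bigcap_minimal]).  Since
    [S_i^-1 R] is simple Artinian, the extension to it of the intersection of the
    [a_j] with [j <> i] is everything, which yields [c_i] in [S_i] lying in all
    other [a_j] ([separating_element]).  The image of [c_i] in the product of the
    [S_j^-1 R] is a unit in place [i] and zero elsewhere, so sums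
    [\sum_i c_i * x_i] realize independent fractions in all factors over a common
    regular denominator: the product is the left quotient ring of [R]
    ([rprod_localization]).  It is Artinian and semiprime, hence semisimple.
    Uniqueness of localizations ([loc_unique]) turns this into the isomorphism
    from [Q] onto the product. *)

(** * Ideals and primes *)

Section IdealBasics.
Variable R : nzRingType.
Implicit Types (I J P : set R) (x y r : R).

Lemma left_idealN I x : left_ideal I -> I x -> I (- x).
Proof. by case=> _ _ IM Ix; rewrite -mulN1r; apply: IM. Qed.

Lemma left_idealB I x y : left_ideal I -> I x -> I y -> I (x - y).
Proof.
by move=> lI Ix Iy; case: (lI) => _ ID _; apply: ID => //; apply: left_idealN.
Qed.

Lemma left_ideal1 I : left_ideal I -> I 1 -> I = setT.
Proof.
case=> _ _ IM I1; rewrite -subTset => x _.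
by rewrite -[x]mulr1; apply: IM.
Qed.

Lemma left_ideal0 : left_ideal ([set 0] : set R).
Proof.
by split=> // [x y -> ->|r x ->] /=; rewrite ?addr0 ?mulr0.
Qed.

Lemma twosided_ideal0 : twosided_ideal ([set 0] : set R).
Proof. by split; [exact: left_ideal0 | move=> r x -> /=; rewrite mul0r]. Qed.

Lemma left_idealI I J : left_ideal I -> left_ideal J -> left_ideal (I `&` J).
Proof.
move=> [I0 ID IM] [J0 JD JM]; split=> //.
  by move=> x y [Ix Jx] [Iy Jy]; split; [apply: ID | apply: JD].
by move=> r x [Ix Jx]; split; [apply: IM | apply: JM].
Qed.

Lemma twosided_idealI I J :
  twosided_ideal I -> twosided_ideal J -> twosided_ideal (I `&` J).
Proof.
move=> [lI rI] [lJ rJ]; split; first exact: left_idealI.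
by move=> r x [Ix Jx]; split; [apply: rI | apply: rJ].
Qed.

Lemma twosided_ideal_bigcap (T : Type) (D : T -> Prop) (A : T -> set R) :
  (forall t, D t -> twosided_ideal (A t)) ->
  twosided_ideal [set x | forall t, D t -> A t x].
Proof.
move=> tA; split; [split|] => /=.
- by move=> t /tA[[]].
- by move=> x y Ax Ay t Dt; have [[_ AD _] _] := tA t Dt; apply: AD;
    [apply: Ax | apply: Ay].
- by move=> r x Ax t Dt; have [[_ _ AM] _] := tA t Dt; apply: AM; apply: Ax.
- by move=> r x Ax t Dt; have [_ rA] := tA t Dt; apply: rA; apply: Ax.
Qed.

Lemma twosided_ideal_sum I J : twosided_ideal I -> twosided_ideal J ->
  twosided_ideal [set z | exists x y, [/\ I x, J y & z = x + y]].
Proof.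
move=> [[I0 ID IM] rI] [[J0 JD JM] rJ]; split; [split|].
- by exists 0, 0; rewrite addr0.
- move=> _ _ [x [y [Ix Jy ->]]] [x' [y' [Ix' Jy' ->]]].
  by exists (x + x'), (y + y'); rewrite addrACA; split;
    [apply: ID | apply: JD |].
- move=> r _ [x [y [Ix Jy ->]]].
  by exists (r * x), (r * y); rewrite mulrDr; split; [apply: IM | apply: JM |].
- move=> r _ [x [y [Ix Jy ->]]].
  by exists (x * r), (y * r); rewrite mulrDl; split; [apply: rI | apply: rJ |].
Qed.

End IdealBasics.

Section Primes.
Variable R : nzRingType.
Implicit Types (I J P : set R) (x y r : R).

(** Pairs of annihilators replace the ideals generated by [x] and by [y], so
    that no finite sums are needed. *)
Lemma ideal_pair_of_elements P x y : twosided_ideal P ->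
  (forall r, P (x * r * y)) ->
  exists I J, [/\ twosided_ideal I, twosided_ideal J, I x, J y &
    forall u v, I u -> J v -> P (u * v)].
Proof.
move=> [[P0 PD PM] rP] Pxy.
exists [set u | forall r, P (u * r * y)].
exists [set v | forall u, (forall r, P (u * r * y)) -> P (u * v)].
split=> //=.
- split; [split|] => /=.
  + by move=> r; rewrite !mul0r.
  + by move=> u v Pu Pv r; rewrite !mulrDl; apply: PD.
  + by move=> t u Pu r; rewrite -!mulrA; apply: (PM); rewrite mulrA; apply: Pu.
  + by move=> t u Pu r; rewrite -[u * t * r]mulrA; apply: Pu.
- split; [split|] => /=.
  + by move=> u _; rewrite mulr0.
  + by move=> v w Pv Pw u Pu; rewrite mulrDr; apply: PD;
      [apply: Pv | apply: Pw].
  + move=> t v Pv u Pu; rewrite mulrA; apply: Pv => r.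
    by rewrite -[u * t * r]mulrA; apply: Pu.
  + by move=> t v Pv u Pu; rewrite mulrA; apply: rP; apply: Pv.
- by move=> u Pu; rewrite -[u]mulr1.
- by move=> u v Pu; apply.
Qed.

(** Apply semiprimeness to the intersection of the two annihilators. *)
Lemma semiprime_elt x : semiprime_ring R -> (forall r, x * r * x = 0) -> x = 0.
Proof.
move=> sR xRx.
have [I [J [tI tJ Ix Jx IJ]]] :=
  ideal_pair_of_elements _ x x (twosided_ideal0 R) xRx.
have IJ0 : I `&` J = [set 0].
  apply: sR; first exact: twosided_idealI.
  by move=> u v [Iu _] [_ Jv]; apply: IJ.
by have : (I `&` J) x by []; rewrite IJ0.
Qed.

Lemma prime_elt P x y :
  prime_ideal P -> (forall r, P (x * r * y)) -> P x \/ P y.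
Proof.
move=> [tP _ pP] Pxy.
have [I [J [tI tJ Ix Jx IJ]]] := ideal_pair_of_elements _ x y tP Pxy.
by have [IP|JP] := pP _ _ tI tJ IJ; [left; apply: IP | right; apply: JP].
Qed.

Lemma prime_not1 P : prime_ideal P -> ~ P 1.
Proof. by case=> [[lP _]] /eqP PT _ P1; apply: PT; apply: left_ideal1. Qed.

(** A prime containing a finite intersection of ideals contains one of them, in
    contrapositive form: multiply elements [x_j] outside [P], with factors
    inserted to stay outside [P]. *)
Lemma prime_avoid_bigcap (J : eqType) (s : seq J) (A : J -> set R) P :
  prime_ideal P -> (forall j, j \in s -> twosided_ideal (A j)) ->
  (forall j, j \in s -> exists x, A j x /\ ~ P x) ->
  exists y, ~ P y /\ forall j, j \in s -> A j y.
Proof.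
move=> pP; elim: s => [_ _|j s IH tA hA]; first by exists 1; split=> //;
  exact: prime_not1.
have [||y [Py sy]] := IH; try by move=> k ks; [apply: tA || apply: hA];
  rewrite inE ks orbT.
have [x [Ax Px]] := hA j (mem_head _ _).
have [r Pr] : exists r, ~ P (x * r * y).
  by apply: contrapT => /forallNP h; case: (prime_elt P x y pP) => // r;
    apply: contrapT; apply: h.
exists (x * r * y); split=> // k; rewrite inE => /orP[/eqP->|ks].
  by have [_ rA] := tA j (mem_head _ _); rewrite -mulrA; apply: rA.
have [[_ _ lA] _] : twosided_ideal (A k) by apply: tA; rewrite inE ks orbT.
by apply: lA; apply: sy.
Qed.

End Primes.

(** * The minimal primes of a semiprime ring have zero intersection *)

Section MSystems.
Variable R : nzRingType.
Implicit Types (I J M P : set R) (x y r : R).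

(** The noncommutative analogue of a multiplicative set avoiding zero: the
    complements of primes have this property. *)
Definition m_system (M : set R) :=
  ~ M 0 /\ forall x y, M x -> M y -> exists r, M (x * r * y).

Lemma m_system_compl P : prime_ideal P -> m_system (~` P).
Proof.
move=> pP; case: (pP) => [[[P0 _ _] _] _ _]; split; first by apply.
move=> x y Px Py; apply: contrapT => /forallNP h.
by case: (prime_elt _ P x y pP) => // r; apply: contrapT; apply: h.
Qed.

(** Iterate [y |-> y * r * y] from [x], with [r] keeping the value nonzero; each
    term is a left and a right multiple of all the earlier ones. *)
Lemma semiprime_m_system x : semiprime_ring R -> x <> 0 ->
  exists M, m_system M /\ M x.
Proof.
move=> sR x0.
have /choice[g gP] : forall y, exists r, y <> 0 -> y * r * y <> 0.
  move=> y; have [->|y0] := EM (y = 0); first by exists 0.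
  have [r hr] : exists r, y * r * y <> 0.
    apply: contrapT => /forallNP h; apply: y0; apply: semiprime_elt => // r.
    by apply: contrapT; apply: h.
  by exists r.
pose u := fix u k := if k is k'.+1 then u k' * g (u k') * u k' else x.
have uE k : u k.+1 = u k * g (u k) * u k by [].
have u0 k : u k <> 0 by elim: k => //= k IH; apply: gP.
have uD k d : exists t t', u (d + k)%N = u k * t /\ u (d + k)%N = t' * u k.
  elim: d => [|d [t [t' [e e']]]]; first by exists 1, 1; rewrite mulr1 mul1r.
  exists (t * g (u (d + k)%N) * u (d + k)%N), (u (d + k)%N * g (u (d + k)%N) * t').
  by rewrite addSn uE; split; [rewrite !mulrA -e | rewrite -[RHS]mulrA -e'].
exists (range u); split; last by exists 0%N.
split=> [[k _] /u0//|_ _ [i _ <-] [j _ <-]].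
have [t [_ [e _]]] := uD i j; have [_ [t' [_ e']]] := uD j i.
exists (t * g (u (j + i)%N) * t'), (j + i).+1 => //.
rewrite addnC in e'.
by rewrite uE !mulrA -e -[RHS]mulrA -e'.
Qed.

Lemma m_system_maximal M : m_system M -> exists N, [/\ m_system N, M `<=` N &
  forall N', m_system N' -> N `<=` N' -> N' = N].
Proof.
move=> mM.
(* Adding [M] afterwards makes the empty chain harmless. *)
have [|A [mA maxA]] := @Zorn_bigcup R (fun A => m_system (M `|` A)).
  move=> F FP Ftot; split.
    by move=> [|[A FA A0]]; [exact: mM.1 | case: (FP A FA) => + _; apply;
      right].
  have key x y A : F A -> (M `|` A) x -> (M `|` A) y ->
      exists r, (M `|` \bigcup_(X in F) X) (x * r * y).
    move=> FA Ax Ay; have [r [h|h]] := (FP A FA).2 _ _ Ax Ay; exists r;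
      first by left.
    by right; exists A.
  move=> x y [Mx|[A FA Ax]] [My|[B FB By]].
  - by have [r h] := mM.2 _ _ Mx My; exists r; left.
  - by apply: (key x y B) => //; [left | right].
  - by apply: (key x y A) => //; [right | left].
  - have [AB|BA] := Ftot A B FA FB.
      by apply: (key x y B) => //; right => //; apply: AB.
    by apply: (key x y A) => //; right => //; apply: BA.
exists (M `|` A); split=> // N' mN' sN'.
apply: contrapT => ne; apply: (maxA N').
  split; first by move=> z Az; apply: sN'; right.
  move=> N'A; apply: ne; apply/seteqP; split=> // z N'z; right; exact: N'A.
suff -> : M `|` N' = N' by [].
by apply/seteqP; split=> [z [Mz|//]|z]; [apply: sN'; left | right].
Qed.

(** An ideal [P] maximal among those disjoint from [M] is prime: if ideals [I]
    and [J] are not in [P], then [P + I] and [P + J] both meet [M]. *)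
Lemma m_system_disjoint_prime M : m_system M -> M !=set0 ->
  exists P, prime_ideal P /\ forall z, P z -> ~ M z.
Proof.
move=> [M0 mM] [m0 Mm0].
(* Again the zero ideal is added afterwards, for the sake of the empty chain. *)
have [|A [[tP dP] maxA]] := @Zorn_bigcup R
   (fun A => twosided_ideal ([set 0] `|` A) /\ forall z, A z -> ~ M z).
  move=> F FP Ftot; split; last by move=> z [A FA Az]; apply: (FP A FA).2.
  have sF A z : F A -> ([set 0] `|` A) z -> ([set 0] `|` \bigcup_(X in F) X) z.
    by move=> FA [z0|Az]; [left | right; exists A].
  split; [split|].
  - by left.
  - move=> x y; have add A : F A -> ([set 0] `|` A) x -> ([set 0] `|` A) y ->
        ([set 0] `|` \bigcup_(X in F) X) (x + y).
      by move=> FA Ax Ay; apply: (sF A) => //; have [[_ D _] _] :=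
        (FP A FA).1; apply: D.
    move=> [->|[A FA Ax]]; first by rewrite add0r.
    move=> [->|[B FB By]]; first by rewrite addr0; apply: (sF A) => //; right.
    have [AB|BA] := Ftot A B FA FB.
      by apply: (add B) => //; right => //; apply: AB.
    by apply: (add A) => //; right => //; apply: BA.
  - move=> r x [->|[A FA Ax]]; first by left; rewrite mulr0.
    by apply: (sF A) => //; have [[_ _ D] _] := (FP A FA).1; apply: D; right.
  - move=> r x [->|[A FA Ax]]; first by left; rewrite mul0r.
    by apply: (sF A) => //; have [_ D] := (FP A FA).1; apply: D; right.
set P := [set 0] `|` A in tP.
have PM z : P z -> ~ M z by case=> [->|/dP].
have meet I : twosided_ideal I -> ~ I `<=` P -> exists x y, [/\ P x, I y & M (x + y)].
  move=> tI IP; pose S := [set z | exists x y, [/\ P x, I y & z = x + y]].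
  have [P0 _ _] := tP.1; have [I0 _ _] := tI.1.
  have PS : P `<=` S by move=> z Pz; exists z, 0; rewrite addr0.
  have IS : I `<=` S by move=> z Pz; exists 0, z; rewrite add0r.
  apply: contrapT => h; apply: (maxA S).
    split; first by move=> z Az; apply: PS; right.
    by move=> SA; apply: IP => z /IS /SA; right.
  split.
    suff -> : [set 0] `|` S = S by exact: twosided_ideal_sum.
    by apply/seteqP; split=> [z [->|//]|z]; [apply: PS | right].
  by move=> _ [x [y [Px Iy ->]]] Mxy; apply: h; exists x, y.
exists P; split=> //; split=> //.
  by apply/eqP => PT; apply: (PM m0) => //; rewrite PT.
move=> I J tI tJ IJ; apply: contrapT => /not_orP[/(meet I tI) + /(meet J tJ)].
move=> [x [y [Px Iy Mxy]]] [x' [y' [Px' Jy' Mxy']]].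
have [r] := mM _ _ Mxy Mxy'; apply: PM.
have [[_ PD lP] rP] := tP; have [_ rI] := tI.
rewrite mulrDr; apply: (PD); first exact: lP.
by rewrite !mulrDl; apply: PD; [apply: (rP); apply: (rP) | apply: IJ => //;
  apply: rI].
Qed.

(** A nonzero [x] lies in a maximal m-system, whose complement is a minimal
    prime. *)
Lemma semiprime_bigcap_minimal x : semiprime_ring R ->
  (forall P, minimal_primes R P -> P x) -> x = 0.
Proof.
move=> sR Px; apply: contrapT => x0.
have [M0 [mM0 M0x]] := semiprime_m_system x sR x0.
have [M [mM M0M maxM]] := m_system_maximal M0 mM0.
have [|P [pP PM]] := m_system_disjoint_prime M mM; first by exists x;
  apply: M0M.
have cP : ~` P = M by apply: maxM; [exact: m_system_compl | move=> z Mz /PM].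
suff /Px : minimal_primes R P by move/PM; apply; apply: M0M.
split=> // P' pP' P'P; apply: setC_inj; rewrite cP; apply: maxM.
  exact: m_system_compl.
by rewrite -cP; apply: subsetC.
Qed.

End MSystems.

(** * Artinian and semisimple rings *)

Section Artinian.
Variable R : nzRingType.
Implicit Types (I J K : set R) (x y r e : R).

(** The minimum condition, from the chain condition by dependent choice. *)
Lemma artinian_min (F : set (set R)) : left_artinian R -> F !=set0 ->
  (forall I, F I -> left_ideal I) ->
  exists I, F I /\ forall J, F J -> J `<=` I -> J = I.
Proof.
move=> aR [I0 FI0] lF; apply: contrapT => /forallNP h.
have /choice[g gP] : forall I, exists J, F I -> [/\ F J, J `<=` I & J <> I].
  move=> I; have [FI|nFI] := EM (F I); last by exists I.
  apply: contrapT => /forallNP h'; apply: (h I); split=> // J FJ JI.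
  by apply: contrapT => ne; apply: (h' J).
pose u := fix u k := if k is k'.+1 then g (u k') else I0.
have Fu k : F (u k) by elim: k => //= k IH; have [] := gP _ IH.
have [k|k|m /(_ m.+1 (leqnSn m)) /=] := aR u; first exact/lF/Fu.
  by have [] := gP _ (Fu k).
by have [] := gP _ (Fu m).
Qed.

(** The chain of the left ideals [R c^k] becomes stationary, which gives
    [c^m = u c^(m+1)]; cancel. *)
Lemma artinian_right_regular_unit c : left_artinian R ->
  (forall x, x * c = 0 -> x = 0) -> exists u, u * c = 1 /\ c * u = 1.
Proof.
move=> aR rc.
have rck k x : x * c ^+ k = 0 -> x = 0.
  by elim: k => [|k IH]; rewrite ?mulr1 // exprSr mulrA => /rc.
pose I k := [set x * c ^+ k | x in [set: R]].
have [k|k|m /(_ m.+1 (leqnSn m)) e] := aR I.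
- split; first by exists 0; rewrite ?mul0r.
    by move=> _ _ [x _ <-] [y _ <-]; exists (x + y); rewrite ?mulrDl.
  by move=> r _ [x _ <-]; exists (r * x); rewrite ?mulrA.
- by move=> _ [x _ <-]; exists (x * c); rewrite // exprS mulrA.
have [u _ uE] : I m.+1 (c ^+ m) by rewrite e; exists 1; rewrite ?mul1r.
have uc : u * c = 1.
  apply/eqP; rewrite -subr_eq0; apply/eqP; apply: (rck m).
  by rewrite mulrBl mul1r -mulrA -exprS uE subrr.
exists u; split=> //; apply/eqP; rewrite -subr_eq0; apply/eqP; apply: rc.
by rewrite mulrBl mul1r -mulrA uc mulr1 subrr.
Qed.

(** Brauer's lemma.  Some [a] in [I] has [I a <> 0], so [I a = I] by minimality
    and [e a = a] for some [e] in [I]; right multiplication by [a] being injective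
    on [I], this [e] is idempotent. *)
Lemma semiprime_minimal_left_ideal_idempotent I : semiprime_ring R ->
  left_ideal I -> I <> [set 0] ->
  (forall J, left_ideal J -> J `<=` I -> J <> [set 0] -> J = I) ->
  exists e, [/\ I e, e * e = e & e <> 0].
Proof.
move=> sR lI I0 minI; have [Iz ID IM] := lI.
have [x [Ix x0]] : exists x, I x /\ x <> 0.
  apply: contrapT => /forallNP h; apply: I0; apply/seteqP;
    split=> [x Ix|_ -> //].
  by apply: contrapT => x0; apply: (h x).
have [r xrx] : exists r, x * r * x <> 0.
  apply: contrapT => /forallNP h; apply: x0; apply: semiprime_elt => // r.
  by apply: contrapT; apply: h.
set a := r * x; have xa : x * a <> 0 by rewrite mulrA.
have Ia : I a by apply: IM.
have [e [Ie ea]] : exists e, I e /\ e * a = a.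
  suff : [set y * a | y in I] a by case=> e Ie ea; exists e.
  rewrite (minI [set y * a | y in I]) //.
  - split; first by exists 0; rewrite ?mul0r.
      by move=> _ _ [y Iy <-] [z Iz' <-]; exists (y + z); rewrite ?mulrDl //;
        apply: ID.
    by move=> t _ [y Iy <-]; exists (t * y); rewrite ?mulrA //; apply: IM.
  - by move=> _ [y Iy <-]; apply: IM.
  - move=> h; apply: xa; suff : [set y * a | y in I] (x * a) by rewrite h.
    by exists x.
have a0 : a <> 0 by move=> a0; apply: xa; rewrite a0 mulr0.
exists e; split=> //; last by move=> e0; apply: a0; rewrite -ea e0 mul0r.
have J0 : I `&` [set y | y * a = 0] = [set 0].
  apply: contrapT => /minI JI;
    suff : (I `&` [set y | y * a = 0]) e by rewrite /= ea => -[].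
  rewrite JI //; apply: left_idealI => //; split=> /=.
  - by rewrite mul0r.
  - by move=> y z yE zE; rewrite mulrDl yE zE addr0.
  - by move=> t y yE; rewrite -mulrA yE mulr0.
have : (I `&` [set y | y * a = 0]) (e * e - e).
  split; last by rewrite /= mulrBl -mulrA !ea subrr.
  by apply: left_idealB => //; apply: IM.
by rewrite J0 => /eqP; rewrite subr_eq0 => /eqP.
Qed.

Lemma left_ideal_has_idempotent I : left_artinian R -> semiprime_ring R ->
  left_ideal I -> I <> [set 0] -> exists e, [/\ I e, e * e = e & e <> 0].
Proof.
move=> aR sR lI I0.
have [||J [[lJ JI J0] minJ]] := artinian_min
  (fun J => [/\ left_ideal J, J `<=` I & J <> [set 0]]) aR.
- by exists I; split.
- by move=> J [].
have [|e [Je ee e0]] := semiprime_minimal_left_ideal_idempotent J sR lJ J0.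
  by move=> K lK KJ K0; apply: minJ => //; split=> // x /KJ /JI.
by exists e; split=> //; apply: JI.
Qed.

(** Choose an idempotent [e] in [I] with minimal annihilator in [I].  If that
    annihilator [A e] were nonzero, it would contain an idempotent [g <> 0], and
    [e + g - e g] would be an idempotent with a smaller annihilator. *)
Lemma left_ideal_idempotent_generated I : left_artinian R -> semiprime_ring R ->
  left_ideal I -> exists e, I e /\ forall x, I x -> x * e = x.
Proof.
move=> aR sR lI; have [I0 ID IM] := lI.
pose A e := I `&` [set x | x * e = 0].
have lA e : left_ideal (A e).
  apply: left_idealI => //; split=> /=.
  - by rewrite mul0r.
  - by move=> y z yE zE; rewrite mulrDl yE zE addr0.
  - by move=> t y yE; rewrite -mulrA yE mulr0.
have [||_ [[e [Ie ee ->]] mine]] := artinian_min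
   (fun J => exists e, [/\ I e, e * e = e & J = A e]) aR.
- by exists (A 0), 0; rewrite mulr0.
- by move=> _ [e [_ _ ->]].
exists e; split=> // x Ix; apply/eqP; rewrite -subr_eq0; apply/eqP.
suff Ae0 : A e = [set 0].
  suff : A e (x * e - x) by rewrite Ae0.
  split; last by rewrite /= mulrBl -mulrA ee subrr.
  by apply: left_idealB => //; apply: IM.
apply: contrapT => Ae0.
have [g [[Ig /= ge] gg g0]] := left_ideal_has_idempotent _ aR sR (lA e) Ae0.
pose h := e + g - e * g.
have he : h * e = e by rewrite !mulrDl mulNr -mulrA ge mulr0 oppr0 addr0 ee addr0.
have hg : h * g = g by rewrite !mulrDl mulNr -mulrA gg addrAC subrr add0r.
have hh : h * h = h by rewrite {2}/h mulrBr mulrDr mulrA he hg.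
have Ih : I h by apply: left_idealB => //; [apply: ID | apply: IM].
have Ahe : A h = A e.
  apply: mine; first by exists h.
  by move=> y [Iy /= yh]; split; rewrite //= -he mulrA yh mul0r.
have : A h g by rewrite Ahe.
by case=> _ /= gh; apply: g0; rewrite -gg -{2}hg mulrA gh mul0r.
Qed.

Lemma artinian_semiprime_semisimple :
  left_artinian R -> semiprime_ring R -> semisimple_artinian R.
Proof.
move=> aR sR; split=> // I lI; have [_ _ IM] := lI.
have [e [Ie xe]] := left_ideal_idempotent_generated I aR sR lI.
exists [set x | x * e = 0]; split.
- split=> /=; first by rewrite mul0r.
    by move=> y z yE zE; rewrite mulrDl yE zE addr0.
  by move=> t y yE; rewrite -mulrA yE mulr0.
- apply/seteqP; split=> [x [Ix /= x0]|_ ->]; first by rewrite /= -(xe x).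
  by have [I0 _ _] := lI; split; rewrite //= mul0r.
- move=> r; exists (r * e), (r - r * e); split; first exact: IM.
    by rewrite /= mulrBl -mulrA (xe e) ?subrr.
  by rewrite addrCA subrr addr0.
Qed.

Definition central e := forall x, e * x = x * e.

Definition ideal_unit K e :=
  [/\ K e, central e & forall x, K x -> x * e = x].

(** A complement of a nilpotent ideal [I] decomposes [1] as [e + e'], and both
    [I e] and [I e'] vanish. *)
Lemma semisimple_semiprime : semisimple_artinian R -> semiprime_ring R.
Proof.
move=> [sR _] I [lI rI] II.
have [J [lJ IJ dec]] := sR I lI.
have [e [e' [Ie Je e1]]] := dec 1.
apply/seteqP; split=> [x Ix|_ ->]; last by case: lI.
suff xe' : x * e' = 0 by rewrite /= -[x]mulr1 e1 mulrDr xe' II ?addr0.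
have : (I `&` J) (x * e') by split; [apply: rI | case: lJ => _ _; apply].
by rewrite IJ.
Qed.

Lemma semisimple_ideal_unit K : semisimple_artinian R -> twosided_ideal K ->
  exists e, ideal_unit K e.
Proof.
move=> ssR tK; have [lK rK] := tK.
have sR := semisimple_semiprime ssR.
have [e [Ke xe]] := left_ideal_idempotent_generated K ssR.2 sR lK.
have [_ _ KM] := lK.
have ex x : K x -> e * x = x.
  move=> Kx; apply/eqP; rewrite eq_sym -subr_eq0; apply/eqP.
  set d := x - e * x.
  have Kd : K d by apply: left_idealB => //; apply: (rK).
  (* [d] absorbs [e] on the right, up to a factor, and [e] kills it. *)
  have ed : e * d = 0 by rewrite mulrBr mulrA (xe e) // subrr.
  by apply: semiprime_elt => // r; rewrite -(xe _ (rK r d Kd)) -mulrA ed mulr0.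
exists e; split=> // x.
by rewrite -(xe _ (rK x e Ke)) -mulrA ex //; apply: KM.
Qed.

(** For a central idempotent [e], the last clause says that [R e] is a minimal
    nonzero ideal. *)
Definition primitive e := [/\ e <> 0, central e, e * e = e &
  forall K, twosided_ideal K -> K e \/ forall x, K x -> x * e = 0].

Lemma ideal_has_primitive K : semisimple_artinian R -> twosided_ideal K ->
  K <> [set 0] -> exists e, K e /\ primitive e.
Proof.
move=> ssR tK K0.
have [||J [[tJ JK J0] minJ]] := artinian_min
  (fun J => [/\ twosided_ideal J, J `<=` K & J <> [set 0]]) ssR.2.
- by exists K; split.
- by move=> J [[]].
have [e [Je ce xe]] := semisimple_ideal_unit J ssR tJ.
exists e; split; first exact: JK.
split=> //.
- move=> e0; apply: J0; apply/seteqP; split=> [x Jx|_ ->];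
    last by case: tJ => -[].
  by rewrite /= -(xe x Jx) e0 mulr0.
- exact: xe.
move=> L tL; have [L0|L0] := EM (L `&` J = [set 0]).
  right=> x Lx; have : (L `&` J) (x * e).
    by split; [apply: tL.2 | case: tJ.1 => _ _; apply].
  by rewrite L0.
left; suff LJ : L `&` J = J by have [] : (L `&` J) e by rewrite LJ.
apply: minJ; last by move=> x [].
by split=> //; [exact: twosided_idealI | move=> x [_ /JK]].
Qed.

Lemma primitive_orthogonal e e' :
  primitive e -> primitive e' -> e <> e' -> e * e' = 0.
Proof.
have half u v : primitive u -> primitive v -> u * v = u \/ u * v = 0.
  move=> [_ cu uu pu] [_ cv vv _].
  case: (pu [set x | x * v = x]) => [|->|h]; last 2 first.
  - by left.
  - by right; rewrite cu; apply: h => /=.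
  split; [split|] => /=.
  - by rewrite mul0r.
  - by move=> x y xE yE; rewrite mulrDl xE yE.
  - by move=> r x xE; rewrite -mulrA xE.
  - by move=> r x xE; rewrite -mulrA -cv mulrA xE.
move=> pe pe' ne; case: (half _ _ pe pe') => // h.
case: (half _ _ pe' pe) => h'; last by case: pe => _ ce _ _; rewrite ce.
by case: ne; rewrite -h; case: pe => _ ce _ _; rewrite ce.
Qed.

(** Among the finite sets of primitive idempotents take one with minimal
    annihilator; if the annihilator were nonzero, it would contain another
    primitive idempotent.  This is the decomposition of [R] into its simple
    components. *)
Lemma semisimple_primitive_seq : semisimple_artinian R ->
  exists s : seq R, [/\ uniq s, forall e, e \in s -> primitive e &
    forall x, (forall e, e \in s -> x * e = 0) -> x = 0].
Proof.
move=> ssR.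
pose A (s : seq R) := [set x | forall e, e \in s -> x * e = 0].
have lA s : left_ideal (A s).
  split=> /= [e _|x y xE yE e es|r x xE e es]; first by rewrite mul0r.
    by rewrite mulrDl xE ?yE ?addr0.
  by rewrite -mulrA xE ?mulr0.
have [||_ [[s [us ps ->]] mins]] := artinian_min
   (fun J => exists s, [/\ uniq s, forall e, e \in s -> primitive e & J = A s]) ssR.2.
- by exists (A [::]), [::].
- by move=> _ [s [_ _ ->]].
exists s; split=> // x Ax.
suff As0 : A s = [set 0] by have : A s x by []; rewrite As0.
apply: contrapT => As0.
have tA : twosided_ideal (A s).
  split=> // r y yE e es; have [_ ce _ _] := ps e es.
  by rewrite -mulrA -ce mulrA yE ?mul0r.
have [e [Ae pe]] := ideal_has_primitive _ ssR tA As0.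
have [e0 ce ee _] := pe.
have es : e \notin s by apply/negP => es; apply: e0; rewrite -ee; apply: Ae.
have AE : A (e :: s) = A s.
  apply: mins; last by move=> y yE e' es'; apply: yE; rewrite inE es' orbT.
  exists (e :: s); split=> //=; first by rewrite es.
  by move=> e'; rewrite inE => /orP[/eqP->|/ps].
have : A (e :: s) e by rewrite AE.
by move=> /(_ e (mem_head _ _)); rewrite ee.
Qed.

End Artinian.

Arguments central {R} e.
Arguments ideal_unit {R} K e.
Arguments primitive {R} e.

Lemma surjective_artinian (R T : nzRingType) (p : {rmorphism R -> T}) :
  (forall y, exists x, p x = y) -> left_artinian R -> left_artinian T.
Proof.
move=> sp aR I lI dI.
have [k|k x|m h] := aR (fun k => p @^-1` (I k)).
- have [I0 ID IM] := lI k; split=> /=; first by rewrite rmorph0.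
    by move=> x y; rewrite rmorphD; apply: ID.
  by move=> r x; rewrite rmorphM; apply: IM.
- exact: dI.
exists m => k mk; apply/seteqP; split=> y; have [x <-] := sp y.
  by rewrite -[I k _]/((p @^-1` (I k)) x) h.
by rewrite -[I m _]/((p @^-1` (I m)) x) -(h k mk).
Qed.

(** * Localizations *)

Section Localization.
Variable R : nzRingType.
Implicit Types (S : set R) (x y r s : R).

Section OneLocalization.
Variables (S : set R) (Q : nzRingType) (f : {rmorphism R -> Q}).
Hypothesis lf : is_left_localization S f.

Lemma loc_unit s : S s -> exists u, u * f s = 1 /\ f s * u = 1.
Proof. by case: lf => h _ _; apply: h. Qed.

Lemma loc_lreg s q : S s -> f s * q = 0 -> q = 0.
Proof. by move=> /loc_unit[u [us _]] sq;
  rewrite -[q]mul1r -us -mulrA sq mulr0. Qed.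

Lemma loc_frac q : exists s r, S s /\ f s * q = f r.
Proof.
case: lf => _ h _; have [s [u [r [Ss us su ->]]]] := h q.
by exists s, r; rewrite mulrA su mul1r.
Qed.

Lemma loc_eq0 r : f r = 0 <-> ass S r.
Proof. by case: lf. Qed.

(** The converse of Ore's construction: commuting a fraction past a denominator
    inside [Q] gives the Ore condition up to [ker f = ass S]. *)
Lemma loc_denominator : multiplicative_set S -> left_denominator S.
Proof.
move=> mS; split; [split=> // r s Ss|].
  have [u [us su]] := loc_unit _ Ss.
  have [t [r' [St e]]] := loc_frac (f r * u).
  have /loc_eq0[c [Sc ce]] : f (t * r - r' * s) = 0.
    by rewrite rmorphB !rmorphM -e -!mulrA us mulr1 subrr.
  exists (c * t), (c * r'); split; first by case: mS => _ _; apply.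
  by apply/eqP; rewrite -subr_eq0 -!mulrA -mulrBr ce.
move=> r s Ss rs; apply/loc_eq0; have [u [us su]] := loc_unit _ Ss.
by rewrite -[f r]mulr1 -su mulrA -rmorphM rs rmorph0 mul0r.
Qed.

(** The left ideal of [Q] generated by [f I].  The equation [f s * q = f x] stands
    for [q = (f s)^-1 * f x] and names no inverse. *)
Definition loc_ext (I : set R) : set Q :=
  [set q | exists s x, [/\ S s, I x & f s * q = f x]].

Lemma loc_ext_sub (I : set R) x : multiplicative_set S -> I x -> loc_ext I (f x).
Proof. by case=> S1 _ _ Ix; exists 1, x; rewrite rmorph1 mul1r. Qed.

Lemma loc_ext_left_ideal (I : set R) :
  left_ore S -> left_ideal I -> left_ideal (loc_ext I).
Proof.
move=> [[S1 S0 SM] oS] [I0 ID IM]; split.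
- by exists 1, 0; rewrite mulr0 rmorph0.
- move=> q q' [s [x [Ss Ix sq]]] [s' [x' [Ss' Ix' sq']]].
  have [a [b [Sa ab]]] := oS s s' Ss'.
  exists (a * s), (a * x + b * x'); split; first exact: SM.
    by apply: ID; apply: IM.
  by rewrite mulrDr {2}ab rmorphD !rmorphM -!mulrA sq sq'.
- move=> p q [s [x [Ss Ix sq]]].
  have [t [r [St tp]]] := loc_frac p.
  have [a [b [Sa ab]]] := oS r s Ss.
  exists (a * t), (b * x); split; [exact: SM | exact: IM |].
  by rewrite !rmorphM -mulrA [f t * _]mulrA tp mulrA -rmorphM ab rmorphM -mulrA sq.
Qed.

(** The extension is stable under right multiplication by [f R].  For
    [u = (f s)^-1] the left ideals [{q | q u^k in I^e}] form a descending chain,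
    and where it becomes stationary, [I^e u] falls back into [I^e]. *)
Lemma loc_ext_twosided (I : set R) : left_ore S -> left_artinian Q ->
  twosided_ideal I -> twosided_ideal (loc_ext I).
Proof.
move=> oS aQ [lI rI]; have lE := loc_ext_left_ideal I oS lI; split=> //.
have [E0 ED EM] := lE.
have Ef q r : loc_ext I q -> loc_ext I (q * f r).
  move=> [s [x [Ss Ix sq]]]; exists s, (x * r).
  by rewrite mulrA sq rmorphM; split=> //; apply: rI.
have Eu q s u : S s -> u * f s = 1 -> f s * u = 1 -> loc_ext I q ->
    loc_ext I (q * u).
  move=> Ss us su Eq.
  have [k|k q'|m /(_ m.+1 (leqnSn m)) e] :=
    aQ (fun k => [set q' | loc_ext I (q' * u ^+ k)]).
  - split=> /=; first by rewrite mul0r.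
      by move=> x y Ex Ey; rewrite mulrDl; apply: ED.
    by move=> r x Ex; rewrite -mulrA; apply: EM.
  - by move=> /= /(Ef _ s); rewrite exprSr -!mulrA us mulr1.
  have fu k : f s ^+ k * u ^+ k = 1.
    by elim: k => [|k IH];
      rewrite ?mulr1 // exprSr exprS mulrA -[_ * _ * u]mulrA su mulr1.
  have : [set q' | loc_ext I (q' * u ^+ m)] (q * f s ^+ m).
    by rewrite /= -mulrA fu mulr1.
  by rewrite -e /= exprSr mulrA -[_ * _ * u ^+ m]mulrA fu mulr1.
move=> p q Eq; case: lf => _ h _; have [s [u [r [Ss us su ->]]]] := h p.
by rewrite mulrA; apply: Ef; apply: (Eu _ s).
Qed.

End OneLocalization.

Lemma ass_twosided S : left_denominator S -> twosided_ideal (ass S).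
Proof.
move=> [[[S1 S0 SM] oS] dS]; split; [split|].
- by exists 1; rewrite mulr0.
- move=> x y [t [St tx]] [t' [St' ty]]; have [a [b [Sa ab]]] := oS t t' St'.
  exists (a * t); split; first exact: SM.
  by rewrite mulrDr {2}ab -!mulrA tx ty !mulr0 addr0.
- move=> r x [t [St tx]]; have [a [b [Sa ab]]] := oS r t St.
  by exists a; rewrite mulrA ab -mulrA tx mulr0.
- by move=> r x [t [St tx]]; exists t; rewrite mulrA tx mul0r.
Qed.

(** Both localizations are related by having equal fractions, [f s * q = f r]
    and [g s * t = g r]; this relation is the graph of the isomorphism. *)
Lemma loc_unique S (Q T : nzRingType) (f : {rmorphism R -> Q})
    (g : {rmorphism R -> T}) : left_ore S ->
  is_left_localization S f -> is_left_localization S g ->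
  exists h : {rmorphism Q -> T}, bijective h.
Proof.
move=> [[S1 S0 SM] oS] lf lg.
pose rel (Q T : nzRingType) (f : {rmorphism R -> Q}) (g : {rmorphism R -> T}) q t :=
  exists s r, [/\ S s, f s * q = f r & g s * t = g r].
have relC Q' T' f' g' q t : rel Q' T' f' g' q t -> rel T' Q' g' f' t q.
  by move=> [s [r [Ss sq st]]]; exists s, r.
have relT Q' T' f' g' (lf' : is_left_localization S f')
    (lg' : is_left_localization S g') q : exists t, rel Q' T' f' g' q t.
  have [s [r [Ss sq]]] := loc_frac _ _ _ lf' q.
  have [u [us su]] := loc_unit _ _ _ lg' _ Ss.
  by exists (u * g' r), s, r; rewrite mulrA su mul1r.
have rel_uniq Q' T' f' g' (lf' : is_left_localization S f')
    (lg' : is_left_localization S g') q t t' :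
    rel Q' T' f' g' q t -> rel Q' T' f' g' q t' -> t = t'.
  move=> [s [r [Ss sq st]]] [s' [r' [Ss' sq' st']]].
  have [a [b [Sa ab]]] := oS s s' Ss'.
  have /(loc_eq0 _ _ _ lf')/(loc_eq0 _ _ _ lg') : f' (a * r - b * r') = 0.
    by rewrite rmorphB !rmorphM -sq -sq' !mulrA -!rmorphM ab subrr.
  rewrite rmorphB !rmorphM -st -st' !mulrA -!rmorphM -ab -mulrBr.
  by move=> /(loc_lreg _ _ _ lg' _ _ (SM _ _ Sa Ss))/eqP;
    rewrite subr_eq0 => /eqP.
have [h hP] := choice (relT _ _ f g lf lg).
have [k kP] := choice (relT _ _ g f lg lf).
have hE q t : rel _ _ f g q t -> h q = t by apply: (rel_uniq _ _ f g lf lg q).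
have hB : zmod_morphism h.
  move=> q q'; apply: hE; have [s [r [Ss sq st]]] := hP q.
  have [s' [r' [Ss' sq' st']]] := hP q'; have [a [b [Sa ab]]] := oS s s' Ss'.
  exists (a * s), (a * r - b * r'); split; first exact: SM.
    by rewrite mulrBr {2}ab rmorphB !rmorphM -!mulrA sq sq'.
  by rewrite mulrBr {2}ab rmorphB !rmorphM -!mulrA st st'.
have hM : monoid_morphism h.
  split; first by apply: hE; exists 1, 1; rewrite !rmorph1 !mulr1.
  move=> q q'; apply: hE; have [s [r [Ss sq st]]] := hP q.
  have [s' [r' [Ss' sq' st']]] := hP q'; have [a [b [Sa ab]]] := oS r s' Ss'.
  exists (a * s), (b * r'); split; first exact: SM.
    by rewrite !rmorphM -mulrA [f s * _]mulrA sq mulrA -rmorphM ab rmorphM -mulrA sq'.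
  by rewrite !rmorphM -mulrA [g s * _]mulrA st mulrA -rmorphM ab rmorphM -mulrA st'.
pose H : {rmorphism Q -> T} := HB.pack h
  (GRing.isZmodMorphism.Build _ _ h hB) (GRing.isMonoidMorphism.Build _ _ h hM).
exists H; exists k => [q|t]; last by apply: hE; apply: relC.
by apply: (rel_uniq _ _ g f lg lf (h q)); [exact: kP | apply: relC].
Qed.

End Localization.

Arguments loc_ext {R} S {Q} f I.

(** * Elements regular modulo an ideal *)

Section RegularMod.
Variable R : nzRingType.
Implicit Types (P I : set R) (c r : R).

(** The preimage of the regular elements of [R / P], in terms of the set [P]
    alone, so that equal ideals visibly give equal sets. *)
Definition regular_mod P : set R :=
  [set c | forall r, (P (c * r) -> P r) /\ (P (r * c) -> P r)].

Lemma regular_preimageE (I : ideal R) : regular_preimage I = regular_mod I.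
Proof.
apply/seteqP; split=> c /=.
  move=> [lc rc] r; rewrite -!quot_pi_eq0 !rmorphM /=; split=> h.
    by apply: lc; rewrite h mulr0.
  by apply: rc; rewrite h mul0r.
move=> h; split=> x y; rewrite -[x]quot_reprK -[y]quot_reprK.
  rewrite -!rmorphM => /quot_pi_eq; rewrite -mulrBr => /(h _).1 => ?.
  exact/quot_pi_eq.
rewrite -!rmorphM => /quot_pi_eq; rewrite -mulrBl => /(h _).2 => ?.
exact/quot_pi_eq.
Qed.

Lemma regular_elementsE : regular_elements R = regular_mod [set 0].
Proof.
apply/seteqP; split=> c.
  move=> [lc rc] r; split=> /= h; first by apply: lc; rewrite h mulr0.
  by apply: rc; rewrite h mul0r.
move=> h; split=> x y /eqP; rewrite -subr_eq0.
  by rewrite -mulrBr => /eqP /(h _).1 /eqP; rewrite subr_eq0 => /eqP.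
by rewrite -mulrBl => /eqP /(h _).2 /eqP; rewrite subr_eq0 => /eqP.
Qed.

Lemma regular_mod_multiplicative P :
  P 0 -> ~ P 1 -> multiplicative_set (regular_mod P).
Proof.
move=> P0 P1; split.
- by move=> r; rewrite mulr1 mul1r.
- by move=> h; apply: P1; apply: (h 1).1; rewrite mul0r.
move=> s t hs ht r; split; first by rewrite -mulrA => /(hs _).1/(ht _).1.
by rewrite mulrA => /(ht _).2/(hs _).2.
Qed.

Lemma unit_regular_mod (T : nzRingType) (h : {rmorphism R -> T}) P c :
  (forall r, h r = 0 <-> P r) -> (exists u, u * h c = 1 /\ h c * u = 1) ->
  regular_mod P c.
Proof.
move=> hP [u [uc cu]] r; rewrite -!hP !rmorphM; split=> e.
  by rewrite -[h r]mul1r -uc -mulrA e mulr0.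
by rewrite -[h r]mulr1 -cu mulrA e mul0r.
Qed.

(** As [I] and [P] meet in zero, [r c] in [P] gives [I r c = 0], hence [I r = 0]
    for [c] regular, and so [r] is in [P]. *)
Lemma regular_sub_regular_mod P I : prime_ideal P -> twosided_ideal I ->
  (forall x, I x -> P x -> x = 0) -> ~ I `<=` P ->
  regular_mod [set 0] `<=` regular_mod P.
Proof.
move=> pP [[_ _ lI] rI] IP0 nIP c hc.
have [y [Iy Py]] : exists y, I y /\ ~ P y.
  by apply: contrapT => /forallNP h; apply: nIP => y Iy;
    apply: contrapT => Py; apply: (h y).
have [[[P0 _ lP] rP] _ _] := pP.
move=> r; split=> Pr.
  case: (prime_elt _ P r y pP) => // t.
  suff -> : r * t * y = 0 by [].
  apply: (hc _).1; apply: IP0; first by apply: (lI); apply: (lI).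
  by rewrite !mulrA; apply: (rP); apply: (rP).
case: (prime_elt _ P y r pP) => // t.
suff -> : y * t * r = 0 by [].
apply: (hc _).2; apply: IP0; last by rewrite -mulrA; apply: lP.
by rewrite -!mulrA; apply: rI.
Qed.

(** Over an Artinian target a fraction ring whose denominators are only some of
    the elements regular modulo [P] already inverts all of them. *)
Lemma loc_regular_mod P (T : nzRingType) (h : {rmorphism R -> T}) :
  left_artinian T -> (forall r, h r = 0 <-> P r) ->
  (forall q, exists s u r, [/\ regular_mod P s, u * h s = 1, h s * u = 1 & q = u * h r]) ->
  (forall r, P r -> exists c, regular_mod P c /\ c * r = 0) ->
  is_left_localization (regular_mod P) h.
Proof.
move=> aT hP fr Pass; split=> // [s hs|r].
  apply: artinian_right_regular_unit => // q;
    have [t [u [r [_ ut tu ->]]]] := fr q.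
  move=> e; have /hP/(hs _).2/hP -> : h (r * s) = 0; last by rewrite mulr0.
  by rewrite -mulrA in e; rewrite rmorphM -[h r]mul1r -tu -!mulrA e mulr0.
rewrite hP; split=> [/Pass[c []]|[c [hc cr]]]; first by exists c.
by apply: (hc _).1; rewrite cr; apply/hP; rewrite rmorph0.
Qed.

End RegularMod.

Arguments regular_mod {R} P.

(** * Finite products of simple Artinian rings *)

Section Product.
Variables (I : finType) (T : I -> nzRingType) (i0 : I).
Local Notation prodT := {dffun forall i, T i}.

Lemma rprod_one_neq0 : (1 : prodT) != 0.
Proof. by apply/eqP => /ffunP/(_ i0); rewrite !ffunE => /eqP;
  rewrite oner_eq0. Qed.

(** An element [i0] of the index type is what makes the product nonzero. *)
Definition rprod : nzRingType :=
  HB.pack prodT (GRing.PzSemiRing_isNonZero.Build prodT rprod_one_neq0).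

Definition rprod_inj i (y : T i) : prodT :=
  [ffun j => dfwith (fun j => 0 : T j) y j].

Lemma rprod_inj_in i (y : T i) : rprod_inj i y i = y.
Proof. by rewrite ffunE dfwith_in. Qed.

Lemma rprod_inj_out i (y : T i) j : j != i -> rprod_inj i y j = 0.
Proof. by move=> ji; rewrite ffunE dfwith_out // eq_sym. Qed.

Lemma rprodDE (x y : prodT) i : (x + y) i = x i + y i.
Proof. by rewrite ffunE. Qed.

Lemma rprodME (x y : prodT) i : (x * y) i = x i * y i.
Proof. by rewrite ffunE. Qed.

Lemma rprod0E i : (0 : prodT) i = 0.
Proof. by rewrite ffunE. Qed.

Lemma rprod_injP i (y : T i) (x : prodT) :
  x i = y -> (forall j, j != i -> x j = 0) -> x = rprod_inj i y.
Proof.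
move=> xi xj; apply/ffunP => j; have [->|ji] := eqVneq j i.
  by rewrite xi rprod_inj_in.
by rewrite xj // rprod_inj_out.
Qed.

Lemma rprod_injD i (y z : T i) : rprod_inj i (y + z) = rprod_inj i y + rprod_inj i z.
Proof.
apply/esym/rprod_injP; first by rewrite rprodDE !rprod_inj_in.
by move=> j ji; rewrite rprodDE !rprod_inj_out // addr0.
Qed.

Lemma rprod_inj0 i : rprod_inj i 0 = 0.
Proof. by apply/esym/rprod_injP => [|j _]; rewrite rprod0E. Qed.

Lemma rprod_injMl i (y : T i) (x : prodT) : rprod_inj i y * x = rprod_inj i (y * x i).
Proof.
apply/rprod_injP; first by rewrite rprodME rprod_inj_in.
by move=> j ji; rewrite rprodME rprod_inj_out // mul0r.
Qed.

Lemma rprod_sum (x : prodT) : x = \sum_i rprod_inj i (x i).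
Proof.
apply/ffunP => i.
rewrite (big_morph (fun x : prodT => x i) (fun x y => rprodDE x y i) (rprod0E i)).
rewrite (bigD1 i) //= rprod_inj_in big1 ?addr0 // => j ji.
by rewrite rprod_inj_out // eq_sym.
Qed.

Section Ideal.
Variable J : set rprod.

Definition rprod_comp i : set (T i) := [set y | J (rprod_inj i y)].

Lemma rprod_comp_left_ideal i : left_ideal J -> left_ideal (rprod_comp i).
Proof.
move=> [J0 JD JM]; rewrite /rprod_comp; split=> /=.
- by rewrite rprod_inj0.
- by move=> y z Jy Jz; rewrite rprod_injD; apply: JD.
- by move=> r y Jy; have := JM (rprod_inj i r) _ Jy;
    rewrite rprod_injMl rprod_inj_in.
Qed.

Lemma rprod_comp_twosided i : twosided_ideal J -> twosided_ideal (rprod_comp i).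
Proof.
move=> [lJ rJ]; split; first exact: rprod_comp_left_ideal.
by move=> r y Jy; have := rJ (rprod_inj i r) _ Jy;
  rewrite rprod_injMl rprod_inj_in.
Qed.

(** A left ideal of a finite product is the product of its components. *)
Lemma rprod_left_idealP (x : prodT) : left_ideal J ->
  J x <-> forall i, rprod_comp i (x i).
Proof.
move=> [J0 JD JM]; split=> [Jx i|Jx].
  by have := JM (rprod_inj i 1) _ Jx; rewrite rprod_injMl mul1r.
rewrite (rprod_sum x); elim/big_ind: _ => // i _; exact: Jx.
Qed.
End Ideal.

Lemma rprod_artinian : (forall i, left_artinian (T i)) -> left_artinian rprod.
Proof.
move=> aT J lJ dJ.
have /choice[m mP] : forall i, exists m, forall k, (m <= k)%N ->
    rprod_comp (J k) i = rprod_comp (J m) i.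
  move=> i; apply: (aT i) => k; first exact: rprod_comp_left_ideal.
  by move=> y; apply: dJ.
exists (\max_i m i)%N => k mk.
apply/seteqP; split=> x /(rprod_left_idealP _ x (lJ _)) Jx;
  apply/(rprod_left_idealP _ x (lJ _)) => i; have := Jx i.
  by rewrite [in X in X -> _]mP ?mP ?leq_bigmax // (leq_trans _ mk) ?leq_bigmax.
by rewrite [in X in X -> _]mP ?mP ?leq_bigmax // (leq_trans _ mk) ?leq_bigmax.
Qed.

Lemma rprod_semiprime : (forall i, simple_ring (T i)) -> semiprime_ring rprod.
Proof.
move=> sT J tJ JJ; apply/seteqP; split=> [x Jx|_ ->]; last by case: tJ => -[].
apply/ffunP => i; rewrite rprod0E.
have := (rprod_left_idealP _ x tJ.1).1 Jx i.
case: (sT i _ (rprod_comp_twosided _ i tJ)) => [->//|JT _].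
have J1 : rprod_comp J i 1 by rewrite JT.
have /ffunP/(_ i)/eqP := JJ _ _ J1 J1.
by rewrite rprodME rprod_inj_in rprod0E mulr1 oner_eq0.
Qed.

Lemma rprod_semisimple : (forall i, simple_ring (T i)) ->
  (forall i, left_artinian (T i)) -> semisimple_artinian rprod.
Proof.
move=> sT aT; apply: artinian_semiprime_semisimple.
  exact: rprod_artinian.
exact: rprod_semiprime.
Qed.

Section ProductMap.
Variables (R : nzRingType) (f : forall i, {rmorphism R -> T i}).

Definition rprod_fun (r : R) : prodT := [ffun i => f i r].

Lemma rprod_fun_zmod : zmod_morphism rprod_fun.
Proof. by move=> x y; apply/ffunP => i; rewrite !ffunE rmorphB. Qed.

Lemma rprod_fun_monoid : monoid_morphism rprod_fun.
Proof.
by split=> [|x y]; apply/ffunP => i; rewrite !ffunE ?rmorph1 ?rmorphM.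
Qed.

Definition rprod_map : {rmorphism R -> rprod} :=
  HB.pack (rprod_fun : R -> rprod)
    (GRing.isZmodMorphism.Build R rprod rprod_fun rprod_fun_zmod)
    (GRing.isMonoidMorphism.Build R rprod rprod_fun rprod_fun_monoid).

(** Multiplying by [c i] and summing over [i] makes the fractions in the separate
    factors into one fraction over a common denominator. *)
Lemma rprod_localization (a : I -> set R) (c : I -> R) :
  (forall i, is_left_localization (regular_mod (a i)) (f i)) ->
  (forall i, left_ideal (a i)) ->
  (forall i, ass (regular_mod (a i)) = a i) ->
  (forall x, (forall i, a i x) -> x = 0) ->
  (forall i, regular_elements R `<=` regular_mod (a i)) ->
  (forall i, regular_mod (a i) (c i)) ->
  (forall i j, j != i -> a j (c i)) ->
  is_left_localization (regular_elements R) rprod_map.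
Proof.
move=> lf la assa a0 Ca Sc ac.
have fE i r : f i r = 0 <-> a i r by rewrite (loc_eq0 _ _ _ _ (lf i)) assa.
have cE (x : I -> R) i : f i (\sum_j c j * x j) = f i (c i) * f i (x i).
  rewrite rmorph_sum (bigD1 i) //= rmorphM big1 ?addr0 // => j ji.
  by rewrite rmorphM (fE i (c j)).2 ?mul0r //; apply: ac; rewrite eq_sym.
have unitP s : regular_elements R s ->
    exists u : rprod, u * rprod_map s = 1 /\ rprod_map s * u = 1.
  move=> Cs.
  have us i : exists u, u * f i s = 1 /\ f i s * u = 1.
    by apply: (loc_unit _ _ _ _ (lf i)); apply: Ca.
  exists ([ffun i => sval (cid (us i))] : prodT).
  by split; apply/ffunP => i; rewrite !ffunE; have [? ?] := svalP (cid (us i)).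
split=> //.
- move=> q.
  have /choice[s sP] : forall i, exists s,
      regular_mod (a i) s /\ exists r, f i s * (q : prodT) i = f i r.
    move=> i; have [s [r [? ?]]] := loc_frac _ _ _ _ (lf i) ((q : prodT) i).
    by exists s; split=> //; exists r.
  have /choice[r rP] i := (sP i).2.
  pose s' := \sum_j c j * s j; pose r' := \sum_j c j * r j.
  have Ss i : regular_mod (a i) s'.
    apply: (unit_regular_mod _ _ (f i)) => //; rewrite cE -rmorphM.
    apply: (loc_unit _ _ _ _ (lf i)) => t; rewrite -!mulrA; split.
      by move=> /(Sc i _).1/((sP i).1 _).1.
    by rewrite mulrA => /((sP i).1 _).2/(Sc i _).2.
  have Cs : regular_elements R s'.
    rewrite regular_elementsE => t; split=> /= h; apply: a0 => i.
      by apply: (Ss i t).1; rewrite h; case: (la i).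
    by apply: (Ss i t).2; rewrite h; case: (la i).
  have [u [us su]] := unitP _ Cs; exists s', u, r'; split=> //.
  suff <- : rprod_map s' * q = rprod_map r' by rewrite mulrA us mul1r.
  by apply/ffunP => i; rewrite !ffunE !cE -mulrA rP.
- move=> r; split=> [/ffunP h|[s [Cs sr]]].
    exists 1; rewrite mul1r; split; first by split=> x y; rewrite ?mulr1 ?mul1r.
    by apply: a0 => i; apply/fE; have := h i; rewrite !ffunE.
  have [u [us _]] := unitP _ Cs.
  by rewrite -[rprod_map r]mul1r -us -mulrA -rmorphM sr rmorph0 mulr0.
Qed.

End ProductMap.
End Product.

(** * Orders in semisimple rings *)

Lemma quotient_ring_exists (R : nzRingType) (I : set R) :
  twosided_ideal I -> ~ I 1 ->
  exists (T : nzRingType) (p : {rmorphism R -> T}),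
    (forall y, exists x, p x = y) /\ forall x, p x = 0 <-> I x.
Proof.
move=> tI I1; pose J := Ideal tI.
have n1 : (1 : quot_ring J) != 0 by apply/eqP => /quot_pi_eq0.
pose T : nzRingType :=
  HB.pack (quot_ring J) (GRing.PzSemiRing_isNonZero.Build (quot_ring J) n1).
exists T, (quot_pi J : {rmorphism R -> quot_ring J}).
split=> [y|x]; last exact: quot_pi_eq0.
by exists (quot_repr y); apply: quot_reprK.
Qed.

Lemma primitive_quotient (Q : nzRingType) (e : Q) :
  left_artinian Q -> primitive e ->
  exists (T : nzRingType) (p : {rmorphism Q -> T}),
    [/\ forall y, exists x, p x = y, forall q, p q = 0 <-> q * e = 0,
        p e = 1, simple_ring T & left_artinian T].
Proof.
move=> aQ [e0 ce ee pe].
have [||T [p [sp kp]]] := quotient_ring_exists Q [set q | q * e = 0].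
- split; [split|] => /=.
  + by rewrite mul0r.
  + by move=> x y xE yE; rewrite mulrDl xE yE addr0.
  + by move=> r x xE; rewrite -mulrA xE mulr0.
  + by move=> r x xE; rewrite -mulrA -ce mulrA xE mul0r.
- by rewrite /= mul1r.
have p1 : p e = 1.
  apply/eqP; rewrite -subr_eq0 -(rmorph1 p) -rmorphB; apply/eqP/kp.
  by rewrite /= mulrBl mul1r ee subrr.
exists T, p; split=> //; last exact: surjective_artinian sp aQ.
move=> I [[I0 ID IM] rI]; case: (pe (p @^-1` I)) => [|Ie|I0e].
- split; [split|] => /=.
  + by rewrite rmorph0.
  + by move=> x y; rewrite rmorphD; apply: ID.
  + by move=> r x; rewrite rmorphM; apply: IM.
  + by move=> r x; rewrite rmorphM; apply: rI.
- by right; apply: left_ideal1 => //; rewrite -p1.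
left; apply/seteqP; split=> [y|_ -> //]; have [x <-] := sp y.
by move=> /I0e/kp.
Qed.

Section Order.
Variables (R Q : nzRingType) (f : {rmorphism R -> Q}).
Hypothesis qf : left_quotient_ring f.
Hypothesis ssQ : semisimple_artinian Q.
Local Notation C := (regular_elements R).

Let oC : left_ore C := qf.1.
Let mC : multiplicative_set C := oC.1.
Let lf : is_left_localization C f := qf.2.
Let aQ : left_artinian Q := ssQ.2.

Lemma order_inj r : f r = 0 -> r = 0.
Proof.
move=> /(loc_eq0 _ _ _ _ lf)[s [Cs sr]].
by case: Cs => ls _; apply: ls; rewrite sr mulr0.
Qed.

(** A square-zero ideal of [R] extends to a square-zero ideal of [Q]. *)
Lemma order_semiprime : semiprime_ring R.
Proof.
move=> N tN NN; have tE := loc_ext_twosided _ _ _ _ lf N oC aQ tN.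
have E0 : loc_ext C f N = [set 0].
  apply: semisimple_semiprime => // p q [s [x [Cs Nx sp]]] [t [y [Ct Ny tq]]].
  apply: (loc_lreg _ _ _ _ lf s) => //; rewrite mulrA sp.
  have [u [ut tu]] := loc_unit _ _ _ _ lf t Ct.
  (* The numerator of [f x * u] comes from [N] again, so it kills [y]. *)
  have [s1 [x1 [Cs1 Nx1 sx1]]] : loc_ext C f N (f x * u).
    by apply: tE.2; apply: loc_ext_sub.
  apply: (loc_lreg _ _ _ _ lf s1) => //.
  rewrite -[q]mul1r -ut -[u * _ * q]mulrA tq [f x * _]mulrA mulrA sx1.
  by rewrite -rmorphM NN // rmorph0.
apply/seteqP; split=> [x Nx|_ ->]; last by case: tN => -[].
apply: order_inj; suff : loc_ext C f N (f x) by rewrite E0.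
exact: loc_ext_sub.
Qed.

Definition component e : set R := [set r | f r * e = 0].

Lemma component_twosided e : central e -> twosided_ideal (component e).
Proof.
move=> ce; rewrite /component; split; [split|] => /=.
- by rewrite rmorph0 mul0r.
- by move=> x y xE yE; rewrite rmorphD mulrDl xE yE addr0.
- by move=> r x xE; rewrite rmorphM -mulrA xE mulr0.
- by move=> r x xE; rewrite rmorphM -mulrA -ce mulrA xE mul0r.
Qed.

(** If neither [I] nor [J] is in [component e], both extensions contain [e], so
    their product contains [e * e = e], which is not killed by [e]. *)
Lemma component_prime e : primitive e -> prime_ideal (component e).
Proof.
move=> [e0 ce ee pe]; split; first exact: component_twosided.
  apply/eqP => cT; have : component e 1 by rewrite cT.
  by rewrite /component /= rmorph1 mul1r.
have inE I : twosided_ideal I -> ~ I `<=` component e -> loc_ext C f I e.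
  move=> tI nI; case: (pe _ (loc_ext_twosided _ _ _ _ lf I oC aQ tI)) => // h.
  by case: nI => x Ix; apply: h; apply: loc_ext_sub.
move=> I J tI tJ IJ; apply: contrapT => /not_orP[/(inE I tI) eI /(inE J tJ)].
move=> [t [y [Ct Jy te]]].
have [u [ut tu]] := loc_unit _ _ _ _ lf t Ct.
have [s [x [Cs Ix sx]]] : loc_ext C f I (e * u).
  by apply: (loc_ext_twosided _ _ _ _ lf I oC aQ tI).2.
apply: e0; apply: (loc_lreg _ _ _ _ lf s) => //.
have eE : e * u * f y = e by rewrite -te mulrA -[e * u * _]mulrA ut mulr1 ee.
have -> : f s * e = f (x * y) * e.
  by rewrite rmorphM -sx -(mulrA (f s)) eE -mulrA ee.
exact: IJ.
Qed.

(** If [e <> e'], then the numerator of [e'] is in [component e] but not in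
    [component e']. *)
Lemma component_sub e e' :
  primitive e -> primitive e' -> component e `<=` component e' -> e = e'.
Proof.
move=> pe pe' sub; apply: contrapT => ne.
have [e'0 ce' ee' _] := pe'.
have e'e : e' * e = 0 by apply: primitive_orthogonal => // /esym.
have [s [r [Cs sr]]] := loc_frac _ _ _ _ lf e'.
have /sub : component e r by rewrite /component /= -sr -mulrA e'e mulr0.
rewrite /component /= -sr -mulrA ee'.
by move/(loc_lreg _ _ _ _ lf s _ Cs).
Qed.

Variable s : seq Q.
Hypothesis us : uniq s.
Hypothesis ps : forall e, e \in s -> primitive e.
Hypothesis s0 : forall x, (forall e, e \in s -> x * e = 0) -> x = 0.

Lemma bigcap_component r : (forall e, e \in s -> component e r) -> r = 0.
Proof. by move=> h; apply: order_inj; apply: s0. Qed.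

Lemma prime_contains_component P :
  prime_ideal P -> exists e, e \in s /\ component e `<=` P.
Proof.
move=> pP; apply: contrapT => /forallNP h.
have [e es|e es|y [Py cy]] := prime_avoid_bigcap _ _ s component P pP.
- by apply: component_twosided; case: (ps e es).
- apply: contrapT => /forallNP h'; apply: (h e); split=> // x cx.
  by apply: contrapT => Px; apply: (h' x).
by apply: Py; rewrite (bigcap_component _ cy); case: pP => -[[]].
Qed.

Lemma minimal_primes_components P :
  minimal_primes R P <-> exists e, e \in s /\ P = component e.
Proof.
split=> [[pP minP]|[e [es ->]]].
  have [e [es eP]] := prime_contains_component P pP; exists e; split=> //.
  by apply/esym; apply: minP => //; apply: component_prime; apply: ps.
split; first by apply: component_prime; apply: ps.
move=> P' pP' P'e; have [e' [es' e'P']] := prime_contains_component P' pP'.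
have ee' : e' = e by apply: component_sub;
  [exact: ps|exact: ps|exact: subset_trans P'e].
by apply/seteqP; split=> //; rewrite -ee'.
Qed.

(** The numerator [c] of [e] is invertible in [Q / ann e] and kills
    [component e], which is therefore the associated ideal. *)
Lemma component_localization e : primitive e ->
  exists (T : nzRingType) (h : {rmorphism R -> T}),
    [/\ is_left_localization (regular_mod (component e)) h,
        forall r, h r = 0 <-> component e r, simple_ring T & left_artinian T].
Proof.
move=> pe; have [T [p [sp kp p1 sT aT]]] := primitive_quotient Q e aQ pe.
have kh r : (p \o f) r = 0 <-> component e r by exact: kp.
have [e0 ce ee _] := pe.
exists T, (p \o f : {rmorphism R -> T}); split=> //.
apply: loc_regular_mod => //.
- move=> y; have [q <-] := sp y;
    case: lf => _ /(_ q) [t [u [r [Ct ut tu ->]]]] _.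
  exists t, (p u), r; rewrite /= -!rmorphM ut tu !rmorph1; split=> //.
  apply: unit_regular_mod kh _; exists (p u).
  by rewrite /= -!rmorphM ut tu !rmorph1.
move=> r cr; have [t [c [Ct tc]]] := loc_frac _ _ _ _ lf e.
exists c; split.
  apply: unit_regular_mod kh _; rewrite /= -tc rmorphM p1 mulr1.
  have [u [ut tu]] := loc_unit _ _ _ _ lf t Ct; exists (p u).
  by rewrite -!rmorphM ut tu !rmorph1.
by apply: order_inj; rewrite rmorphM -tc -mulrA ce cr mulr0.
Qed.

Lemma component_denominator e : primitive e ->
  left_denominator (regular_mod (component e)) /\
  ass (regular_mod (component e)) = component e.
Proof.
move=> pe; have [T [h [lh kh _ _]]] := component_localization e pe.
have [[[c0 _ _] _] _ _] := component_prime e pe.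
have mS : multiplicative_set (regular_mod (component e)).
  by apply: regular_mod_multiplicative => //; apply: prime_not1;
    apply: component_prime.
have dS := loc_denominator _ _ _ _ lh mS; split=> //.
by apply/seteqP; split=> r; rewrite -kh (loc_eq0 _ _ _ _ lh).
Qed.

(** The extension of [ass S] to [Q] contains no element of [f C], hence is a
    proper ideal and misses some [e].  If [y * d = 0] in [Q / ann e] with [d] in
    [S], the numerator of a lift of [y] in [Q e] is in [ass S]; so [y = 0]. *)
Lemma denominator_sub_regular_mod S : left_denominator S ->
  exists e, e \in s /\ S `<=` regular_mod (component e).
Proof.
move=> dS; have tA := ass_twosided _ S dS; have [[[S1 S0 SM] _] rS] := dS.
have tK := loc_ext_twosided _ _ _ _ lf _ oC aQ tA.
set K := loc_ext C f (ass S) in tK.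
have [e [es Ke]] : exists e, e \in s /\ ~ K e.
  apply: contrapT => /forallNP h.
  have [g [Kg cg xg]] := semisimple_ideal_unit _ K ssQ tK.
  have g1 : 1 - g = 0.
    apply: s0 => e es; rewrite mulrBl mul1r cg xg ?subrr //.
    by apply: contrapT => Ke; apply: (h e).
  have : K 1 by have /eqP := g1; rewrite subr_eq0 => /eqP ->.
  move=> [c [x [[lc rc] [t [St tx]]]]]; rewrite mulr1 => /eqP.
  rewrite -subr_eq0 -rmorphB => /eqP/order_inj/eqP; rewrite subr_eq0 => /eqP cx.
  apply: S0; suff <- : t = 0 by [].
  by apply: rc; rewrite cx tx mul0r.
exists e; split=> // d Sd.
have [e0 ce ee pe] := ps e es.
have Ke0 x : K x -> x * e = 0 by case: (pe K tK) => // h; apply: h.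
have [T [p [sp kp p1 _ aT]]] := primitive_quotient Q e aQ (ps e es).
have kh r : (p \o f) r = 0 <-> component e r by exact: kp.
apply: unit_regular_mod kh _.
apply: artinian_right_regular_unit => // y; have [q <-] := sp y.
rewrite /= -rmorphM => /kp qd; apply/kp.
have [t [r [Ct tr]]] := loc_frac _ _ _ _ lf (q * e).
have Kqe : K (q * e).
  exists t, r; split=> //; apply: (rS r d Sd); apply: order_inj.
  by rewrite rmorphM -tr -!mulrA ce [q * _]mulrA qd mulr0.
by rewrite -(Ke0 _ Kqe) -mulrA ee.
Qed.

Lemma order_max_left_denominators :
  max_left_denominators R = regular_mod @` minimal_primes R.
Proof.
have cmpE : minimal_primes R = [set component e | e in [set e | e \in s]].
  by apply/seteqP; split=> P; [move=> /minimal_primes_components[e [es ->]];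
    exists e
    | move=> [e es <-]; apply/minimal_primes_components; exists e].
apply/seteqP; split=> [S [dS maxS]|_ [P mP <-]].
  have [e [es Se]] := denominator_sub_regular_mod S dS.
  exists (component e); first by rewrite cmpE; exists e.
  by apply: maxS => //; have [] := component_denominator e (ps e es).
have [e [es ->]] := (minimal_primes_components P).1 mP.
have [dS aS] := component_denominator e (ps e es).
split=> // S' dS' sub.
have [e' [es' sub']] := denominator_sub_regular_mod S' dS'.
have [_ aS'] := component_denominator e' (ps e' es').
suff ee' : e = e' by apply/seteqP; split=> //; rewrite ee'.
apply: component_sub; [exact: ps | exact: ps |].
by rewrite -aS -aS' => r [c [Sc cr]]; exists c; split=> //; apply/sub'/sub.
Qed.

Lemma order_minimal_prime_conditions : minimal_prime_conditions R.
Proof.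
split; first exact: order_semiprime.
have pn (i : 'I_(size s)) : primitive (s`_i) by apply: ps; apply: mem_nth.
have tc (i : 'I_(size s)) : twosided_ideal (component s`_i).
  by apply: component_twosided; case: (pn i).
exists (size s), (fun i => Ideal (tc i)); split.
- split=> [i j /= ij|].
    apply/val_inj/eqP; rewrite -(nth_uniq 0 (ltn_ord i) (ltn_ord j) us);
      apply/eqP.
    by apply: component_sub => //; rewrite ij.
  apply/seteqP; split=> P; rewrite minimal_primes_components.
    by move=> [i _ <-]; exists s`_i; split=> //; apply: mem_nth.
  move=> [e [es ->]]; have ies : (index e s < size s)%N by rewrite index_mem.
  by exists (Ordinal ies); rewrite //= nth_index.
- by move=> i; rewrite regular_preimageE; apply: component_denominator.
- move=> i; rewrite regular_preimageE.
  by have [T [h [lh _ sT aT]]] := component_localization _ (pn i); exists T, h.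
Qed.

End Order.

(** * Recovering the quotient ring from the minimal primes *)

Section Recover.
Variable R : nzRingType.

(** In the simple ring [S^-1 R] the extension of the intersection of the other
    minimal primes is everything; the numerator of [1] is the element sought. *)
Lemma separating_element n (a : 'I_n -> ideal R) i (T : nzRingType)
    (f : {rmorphism R -> T}) :
  enumerates_minimal_primes a ->
  left_ore (regular_mod (a i)) -> ass (regular_mod (a i)) = a i ->
  is_left_localization (regular_mod (a i)) f ->
  simple_ring T -> left_artinian T ->
  exists c, regular_mod (a i) c /\
    forall P, minimal_primes R P -> P <> a i -> P c.
Proof.
move=> [ia ra] oS assS lf sT aT.
have pa j : minimal_primes R (a j) by rewrite -ra; exists j.
have [pi _] := pa i.
pose b := [set r | forall j, j != i -> ideal_set (a j) r].
have tb : twosided_ideal b.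
  by apply: (twosided_ideal_bigcap _ _ (fun j => j != i)) => j _; apply: idealP.
have [||y [ay by_]] := prime_avoid_bigcap _ _ [seq j <- enum 'I_n | j != i]
   (fun j => ideal_set (a j)) (a i) pi.
- by move=> j _; apply: idealP.
- move=> j; rewrite mem_filter => /andP[/eqP ji _].
  apply: contrapT => /forallNP h; apply: ji; apply: ia.
  apply: (pa i).2; first by case: (pa j).
  by move=> x ajx; apply: contrapT => aix; apply: (h x).
have ext1 : loc_ext (regular_mod (a i)) f b 1.
  case: (sT _ (loc_ext_twosided _ _ _ _ lf b oS aT tb)) => [E0|->//].
  case: ay; suff : ass (regular_mod (a i)) y by rewrite assS.
  apply/(loc_eq0 _ _ _ _ lf);
    suff : loc_ext (regular_mod (a i)) f b (f y) by rewrite E0.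
  apply: loc_ext_sub; first by case: oS.
  by move=> j ji; apply: by_; rewrite mem_filter ji mem_enum.
have [t [c [St bc]]] := ext1; rewrite mulr1 => tc.
exists c; split; last first.
  by rewrite -ra => _ [j _ <-] ji; apply: bc; apply/eqP => jE; rewrite jE in ji.
apply: (unit_regular_mod _ _ f); first by move=> r;
  rewrite (loc_eq0 _ _ _ _ lf) assS.
by rewrite -tc; apply: (loc_unit _ _ _ _ lf).
Qed.

(** Regular elements of [R] lie in every [regular_mod (a i)], because the other
    minimal primes intersect in an ideal that meets [a i] in zero. *)
Lemma recover_quotient_ring n (a : 'I_n -> ideal R) (T : 'I_n -> nzRingType)
    (f : forall i, {rmorphism R -> T i}) :
  semiprime_ring R -> enumerates_minimal_primes a ->
  (forall P, minimal_primes R P -> ass (regular_mod P) = P) ->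
  (forall P, minimal_primes R P -> exists c, regular_mod P c /\
     forall P', minimal_primes R P' -> P' <> P -> P' c) ->
  (forall i, is_left_localization (regular_mod (a i)) (f i)) ->
  exists i0 : 'I_n, left_quotient_ring (rprod_map _ T i0 R f).
Proof.
move=> sR ea assR sep lf; have [ia ra] := ea.
have pa j : minimal_primes R (a j) by rewrite -ra; exists j.
have a0 x : (forall i, ideal_set (a i) x) -> x = 0.
  by move=> ax; apply: semiprime_bigcap_minimal => // P;
    rewrite -ra => -[i _ <-].
have i0 : 'I_n.
  case: n a T f ea lf ia ra pa a0 => [a _ _ _ _ _ _ _ a0|n *]; last exact: ord0.
  by have /eqP := a0 1 (fun i : 'I_0 => False_ind _ (notF (ltn_ord i)));
    rewrite oner_eq0.
have /choice[c cP] := fun i => sep _ (pa i).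
have Ca i : regular_elements R `<=` regular_mod (a i).
  rewrite regular_elementsE.
  have [pi _] := pa i.
  pose b := [set r | forall j, j != i -> ideal_set (a j) r].
  apply: (regular_sub_regular_mod _ _ b) => //.
  - by apply: (twosided_ideal_bigcap _ _ (fun j => j != i)) => j _;
      apply: idealP.
  - move=> x bx ax; apply: a0 => j; have [->//|ji] := eqVneq j i.
    exact: bx.
  have [Sc sc] := cP i; move=> /(_ (c i)) ba; apply: (prime_not1 _ _ pi).
  apply: (Sc 1).1; rewrite mulr1; apply: ba => j ji.
  by apply: sc => // /ia jE; rewrite jE eqxx in ji.
exists i0.
have lQ : is_left_localization (regular_elements R) (rprod_map _ T i0 R f).
  apply: (rprod_localization _ _ _ _ _ (fun i => ideal_set (a i)) c) => //.
  - by move=> i; case: (idealP (a i)).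
  - by move=> i; apply: assR.
  - by move=> i; case: (cP i).
  - move=> i j ji; apply: (cP i).2 => // /ia jE; by rewrite jE eqxx in ji.
split=> //; apply: (loc_denominator _ _ _ _ lQ _).1.
rewrite regular_elementsE; apply: regular_mod_multiplicative => //=.
by apply/eqP; rewrite oner_eq0.
Qed.
End Recover.


Theorem theorem4p1 (R : nzRingType) :
  (has_semisimple_left_quotient_ring R <-> minimal_prime_conditions R) /\
  (has_semisimple_left_quotient_ring R \/ minimal_prime_conditions R ->
   forall (n : nat) (a : 'I_n -> ideal R), enumerates_minimal_primes a ->
     max_left_denominators R = range (fun i => regular_preimage (a i)) /\
     forall (Q : nzRingType) (f : {rmorphism R -> Q})
            (Ri : 'I_n -> nzRingType)
            (fi : forall i, {rmorphism R -> Ri i}),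
       left_quotient_ring f ->
       (forall i, is_left_localization (regular_preimage (a i)) (fi i)) ->
       exists g : {rmorphism Q -> {dffun forall i, Ri i}}, bijective g).
Proof.
have to2 : has_semisimple_left_quotient_ring R -> minimal_prime_conditions R.
  move=> [Q [f [qf ssQ]]]; have [s [us ps s0]] :=
    semisimple_primitive_seq _ ssQ.
  exact: order_minimal_prime_conditions qf ssQ s us ps s0.
have sep : minimal_prime_conditions R -> forall P, minimal_primes R P ->
    ass (regular_mod P) = P /\ exists c, regular_mod P c /\
      forall P', minimal_primes R P' -> P' <> P -> P' c.
  move=> [sR [n [a [ea da la]]]] P; have [ia ra] := ea;
    rewrite -ra => -[i _ <-].
  have [T [f [lf sT aT]]] := la i; have [[oS _] assS] := da i.
  rewrite regular_preimageE in lf oS assS; rewrite ra.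
  by split=> //; apply: (separating_element _ _ _ i T f).
have to1 : minimal_prime_conditions R -> has_semisimple_left_quotient_ring R.
  move=> c2; have sepR := sep c2; have [sR [n [a [ea da la]]]] := c2.
  have /choice[T TP] := la.
  pose f i := sval (cid (TP i)).
  have fP i := svalP (cid (TP i)).
  have [||i|i0 qf] := recover_quotient_ring R n a T f sR ea.
  - by move=> P /sepR[].
  - by move=> P /sepR[].
  - by have [lf _ _] := fP i; rewrite -regular_preimageE.
  exists (rprod _ T i0), (rprod_map _ T i0 R f); split=> //.
  by apply: rprod_semisimple => i; have [] := fP i.
split; first by split.
move=> c12 n a ea.
have [c1 c2] : has_semisimple_left_quotient_ring R /\ minimal_prime_conditions R.
  by case: c12 => h; split=> //; [exact: to2 | exact: to1].
have [sR _] := c2; split.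
  have [Q [f [qf ssQ]]] := c1; have [s [us ps s0]] :=
    semisimple_primitive_seq _ ssQ.
  rewrite (order_max_left_denominators _ _ f qf ssQ s ps s0) -ea.2.
  apply/seteqP; split=> [_ [_ [i _ <-] <-]|_ [i _ <-]].
    by exists i; rewrite ?regular_preimageE.
  by exists (ideal_set (a i)); rewrite ?regular_preimageE //; exists i.
move=> Q f T fi qf lf.
have [||i|i0 qg] := recover_quotient_ring R n a T fi sR ea.
- by move=> P /(sep c2)[].
- by move=> P /(sep c2)[].
- by rewrite -regular_preimageE.
have [g bg] := loc_unique _ _ _ _ _ _ qf.1 qf.2 qg.2.
by exists g.
Qed.
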